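(* Let $p, q, n \in \mathbb{N}$ be such that $p+q \leq n$. Then $$a_{sym}^{\mathbb{R}}(n;p,q) \leq \min\{p,q\}\,\bigl(n - \min\{p,q\}\bigr).$$
   Context: $\mathbb{N}$ includes $0$. $S(n,\mathbb{R})$ denotes the real vector space of symmetric $n\times n$ real matrices. A matrix in $S(n,\mathbb{R})$ has signature $(p,q)$ if it has exactly $p$ positive and exactly $q$ negative eigenvalues, counted with multiplicity. An affine subspace $S$ of $S(n,\mathbb{R})$ is a set of the form $M+L$ with $M \in S(n,\mathbb{R})$ and $L$ a linear subspace of $S(n,\mathbb{R})$; its dimension is $\dim L$. $a_{sym}^{\mathbb{R}}(n;p,q)$ denotes the maximum of $\dim S$ over all affine subspaces $S$ of $S(n,\mathbb{R})$ such that every $A\in S$ has signature $(p,q)$. *)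

(* Defs.v *)
From HB Require Import structures.
From mathcomp Require Import all_boot all_order all_algebra.
From mathcomp Require Import polyrcf.
From mathcomp Require Import boolp classical_sets reals.
Set Implicit Arguments. Unset Strict Implicit. Unset Printing Implicit Defensive.
Import Order.TTheory GRing.Theory Num.Theory.
Local Open Scope classical_set_scope.
Local Open Scope ring_scope.

(* [rootsR] lists each real root once; [mup] restores the multiplicities. *)
Definition nb_eigenvalues (R : realType) (n : nat) (P : pred R) (A : 'M[R]_n)
    : nat :=
  (\sum_(a <- rootsR (char_poly A) | P a) mup a (char_poly A))%N.

Definition has_signature (R : realType) (n : nat) (A : 'M[R]_n) (p q : nat) :
    Prop :=
  nb_eigenvalues (fun a : R => 0 < a) A = p /\
  nb_eigenvalues (fun a : R => a < 0) A = q.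

Definition affine_sym_subspace (R : realType) (n : nat) (S : set 'M[R]_n)
    (d : nat) : Prop :=
  exists (M : 'M[R]_n) (L : {vspace 'M[R]_n}),
    [/\ M^T = M,
        forall N, N \in L -> N^T = N,
        S = [set M + N | N in [set` L]] &
        \dim L = d].

Definition const_signature_dim (R : realType) (n p q d : nat) : Prop :=
  exists2 S : set 'M[R]_n,
    affine_sym_subspace S d & forall A, S A -> has_signature A p q.

(* The search range loses nothing, as a subspace of ['M[R]_n] has dimension at
   most [n * n]; see [a_sym_ub] and [a_sym_attained]. *)
Definition a_sym (R : realType) (n p q : nat) : nat :=
  (\max_(d < (n * n).+1 | `[< const_signature_dim R n p q d >]) d)%N.

Lemma const_signature_dim_le (R : realType) (n p q d : nat) :
  const_signature_dim R n p q d -> (d <= n * n)%N.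
Proof.
move=> [S [M [L [_ _ _ <-]]] _].
by apply: leq_trans (dimvS (subvf L)) _; rewrite dimvf /dim /=.
Qed.

Lemma a_sym_ub (R : realType) (n p q d : nat) :
  const_signature_dim R n p q d -> (d <= a_sym R n p q)%N.
Proof.
move=> Sd; have d_lt : (d < (n * n).+1)%N by exact: const_signature_dim_le Sd.
by rewrite /a_sym (bigD1 (Ordinal d_lt)) /= ?leq_maxl //; exact/asboolP.
Qed.

Lemma nb_eigenvalues_split (R : realType) (n : nat) (P : pred R) (A : 'M[R]_n)
    (s : seq R) :
  char_poly A = \prod_(a <- s) ('X - a%:P) ->
  nb_eigenvalues P A = count P s.
Proof.
move=> cA; have cA0 : char_poly A != 0 by exact/monic_neq0/char_poly_monic.
have perm_s : perm_eq (rootsR (char_poly A)) (undup s).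
  apply: uniq_perm; rewrite ?undup_uniq ?uniq_roots // => a.
  have := roots_on_rootsR cA0 a.
  by rewrite in_itv /= => <-; rewrite cA root_prod_XsubC mem_undup.
rewrite /nb_eigenvalues (perm_big _ perm_s) /= cA -sum1_count.
rewrite -[RHS](big_undup_iterop_count _ s P (fun=> 1%N)) /=.
apply: eq_bigr => a _.
by rewrite mu_prod_XsubC Monoid.iteropE iter_addn_0 mul1n.
Qed.

Lemma const_signature_dim0 (R : realType) (n p q : nat) :
  (p + q <= n)%N -> const_signature_dim R n p q 0.
Proof.
move=> pq_n.
pose f (i : nat) : R := if (i < p)%N then 1 else if (i < p + q)%N then -1 else 0.
pose D : 'M[R]_n := diag_mx (\row_i f i).
have cD : char_poly D = \prod_(a <- [seq f i | i <- iota 0 n]) ('X - a%:P).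
  rewrite char_poly_trig ?diag_mx_is_trig // big_map -[n in iota 0 n]subn0.
  rewrite -/(index_iota 0 n) big_mkord.
  by apply: eq_bigr => i _; rewrite !mxE eqxx mulr1n.
have iota_n : iota 0 n = iota 0 p ++ iota p q ++ iota (p + q) (n - (p + q)).
  by rewrite catA -!iotaD subnKC.
have seg (a : pred nat) m k b :
    (forall i, (m <= i < m + k)%N -> a i = b) ->
    count a (iota m k) = if b then k else 0%N.
  move=> ab; rewrite (@eq_in_count _ _ (fun=> b)) => [|i]; last first.
    by rewrite mem_iota => /ab.
  by case: b {ab}; rewrite ?count_predT ?count_pred0 ?size_iota.
exists [set D + N | N in [set` (0%VS : {vspace 'M[R]_n})]].
  exists D, 0%VS; split=> //; first exact: tr_diag_mx.
    by move=> N; rewrite memv0 => /eqP ->; rewrite trmx0.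
  exact: dimv0.
move=> A [N /=]; rewrite memv0 => /eqP -> <-; rewrite addr0.
split; rewrite (nb_eigenvalues_split _ cD) count_map iota_n !count_cat.
- rewrite (seg _ _ _ true); last by move=> i /andP[_ ip] /=; rewrite /f ip ltr01.
  rewrite (seg _ _ _ false) => [|i /andP[pi ipq] /=]; last first.
    by rewrite /f ltnNge pi /= ipq oppr_gt0 ltr10.
  rewrite (seg _ _ _ false) ?addn0 // => i /andP[pqi _] /=.
  by rewrite /f !ltnNge pqi (leq_trans (leq_addr q p) pqi) /= ltxx.
- rewrite (seg _ _ _ false) => [|i /andP[_ ip] /=]; last by rewrite /f ip ltr10.
  rewrite (seg _ _ _ true) => [|i /andP[pi ipq] /=]; last first.
    by rewrite /f ltnNge pi /= ipq oppr_lt0 ltr01.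
  rewrite (seg _ _ _ false) ?addn0 // => i /andP[pqi _] /=.
  by rewrite /f !ltnNge pqi (leq_trans (leq_addr q p) pqi) /= ltxx.
Qed.

Lemma a_sym_attained (R : realType) (n p q : nat) :
  (p + q <= n)%N -> const_signature_dim R n p q (a_sym R n p q).
Proof.
move=> /(const_signature_dim0 R) S0; rewrite /a_sym.
have P0 : `[< const_signature_dim R n p q (@ord0 (n * n)) >] by exact/asboolP.
by rewrite (bigop.bigmax_eq_arg ord0) //; case: arg_maxnP => // i /asboolP.
Qed.

(* Main.v *)
Require Import Defs.
From mathcomp Require Import all_boot all_order all_algebra.
From mathcomp Require Import complex.
From mathcomp Require Import reals.
From mathcomp Require Import zify ring lra.
Set Implicit Arguments. Unset Strict Implicit. Unset Printing Implicit Defensive.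
Import Order.TTheory GRing.Theory Num.Theory.
Local Open Scope ring_scope.

(** Why the bound holds.  Let every element of the affine space M + L have
    p positive and q negative eigenvalues.  It is enough to prove
    dim L <= p (n - p): the same bound applied to - M + L, whose signature is
    (q, p), gives dim L <= q (n - q), and the smaller of p and q may then be
    chosen ([dim_const_inertia]).

    By a congruence M becomes diagonal with its positive entries equal to 1.
    Let I be the set of the p positions of these entries.  Restricting N in L
    to its block with rows in I and columns outside I maps L linearly to a
    space of dimension p (n - p), and the claim is that this map is injective
    ([inertia_pencil_eq0]).  So let that block of N vanish; then N, which is
    symmetric, is block diagonal, and all the matrices M + t N have the
    signature of M.

    - The block of N on I is 0.  Otherwise it has an eigenvector v for a
      nonzero eigenvalue a; since M acts as the identity on I, v lies in the
      kernel of M - a^-1 N, while v N v^T = a |v|^2 is nonzero.  But in a pencil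
      of constant rank, N vanishes on the kernel of each of its members
      ([bounded_rank_kernel_isotropic]).

    - The block of N outside I is 0.  Otherwise some y supported outside I has
      y N y^T nonzero, so that M + t N is positive at y for a suitable t.  It is
      still positive on the p coordinates of I, and these are orthogonal to y,
      so M + t N is positive definite on a space of dimension p + 1, against
      its signature ([inertia_nonpos_vector]).

    Eigenvalues are linked to quadratic forms by the spectral theorem for real
    symmetric matrices ([symmetric_spectral]). *)

(** * Spectral theorem for real symmetric matrices *)

Lemma mx11_tr (R : pzRingType) (A : 'M[R]_1) : A^T = A.
Proof. by apply/matrixP=> i j; rewrite !ord1 mxE. Qed.

Lemma sqnormE (R : pzRingType) n (x : 'rV[R]_n) :
  (x *m x^T) 0 0 = \sum_i x 0 i ^+ 2.
Proof. by rewrite mxE; apply: eq_bigr => i _; rewrite mxE expr2. Qed.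

Lemma sqnorm_ge0 (R : realDomainType) n (x : 'rV[R]_n) : 0 <= (x *m x^T) 0 0.
Proof. by rewrite sqnormE sumr_ge0 // => i _; exact: sqr_ge0. Qed.

Lemma sqnorm_gt0 (R : realDomainType) n (x : 'rV[R]_n) :
  (0 < (x *m x^T) 0 0) = (x != 0).
Proof.
rewrite lt0r sqnorm_ge0 andbT sqnormE psumr_eq0 => [|i _]; last exact: sqr_ge0.
congr (~~ _); apply/allP/eqP => [x0 | -> i _]; last by rewrite mxE expr0n /=.
apply/rowP=> i; apply/eqP; rewrite mxE -sqrf_eq0.
by move: (x0 i); rewrite mem_index_enum; apply.
Qed.

(** A complex eigenvector x + i y for the eigenvalue a + i b gives
    x A = a x - b y and y A = b x + a y.  Symmetry makes x A y^T and y A x^T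
    equal, so b (|x|^2 + |y|^2) = 0 and b = 0: whichever of x and y is
    nonzero is a real eigenvector. *)
Lemma symmetric_eigenvector (R : rcfType) n (A : 'M[R]_n.+1) :
  A^T = A -> exists a (v : 'rV[R]_n.+1), v != 0 /\ v *m A = a *: v.
Proof.
move=> symA; pose C := R[i]; pose f : R -> C := real_complex R.
have [l /eigenvalueP[z zA z0]] :=
  @spectral.eigenvalue_closed C _ (map_mx f A) isT.
pose x : 'rV[R]_n.+1 := map_mx (@complex.Re R) z.
pose y : 'rV[R]_n.+1 := map_mx (@complex.Im R) z.
pose a := complex.Re l; pose b := complex.Im l.
have zAj j : \sum_k z 0 k * f (A k j) = l * z 0 j.
  have /rowP/(_ j) := zA; rewrite !mxE => <-.
  by apply: eq_bigr => k _; rewrite mxE.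
have xA : x *m A = a *: x - b *: y.
  apply/rowP=> j; rewrite !mxE.
  have := congr1 (@complex.Re R) (zAj j); rewrite raddf_sum /=.
  rewrite [RHS in _ = RHS -> _]
    (_ : _ = a * complex.Re (z 0 j) - b * complex.Im (z 0 j)) => [<-|].
    apply: eq_bigr => k _; rewrite mxE.
    by case: (z 0 k) => u w /=; rewrite mulr0 subr0.
  by rewrite /a /b; case: (l) (z 0 j) => [? ?] [? ?].
have yA : y *m A = b *: x + a *: y.
  apply/rowP=> j; rewrite !mxE.
  have := congr1 (@complex.Im R) (zAj j); rewrite raddf_sum /=.
  rewrite [RHS in _ = RHS -> _]
    (_ : _ = b * complex.Re (z 0 j) + a * complex.Im (z 0 j)) => [<-|].
    apply: eq_bigr => k _; rewrite mxE.
    by case: (z 0 k) => u w /=; rewrite mulr0 add0r.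
  by rewrite /a /b; case: (l) (z 0 j) => [? ?] [? ?] /=; rewrite addrC.
have xy0 : (x != 0) || (y != 0).
  rewrite -negb_and; apply: contra z0 => /andP[/eqP/rowP x0 /eqP/rowP y0].
  apply/eqP/rowP=> j; have := x0 j; have := y0 j; rewrite !mxE.
  by case: (z 0 j) => u w /= -> ->.
have b0 : b = 0.
  have : (x *m A *m y^T) 0 0 = (y *m A *m x^T) 0 0.
    by rewrite -[in LHS](mx11_tr (_ *m y^T)) !trmx_mul trmxK symA mulmxA.
  rewrite xA yA mulmxBl mulmxDl -!scalemxAl.
  rewrite -(mx11_tr (x *m y^T)) trmx_mul trmxK => /eqP.
  rewrite -subr_eq0 !mxE => /eqP h.
  have {}h : b * ((x *m x^T) 0 0 + (y *m y^T) 0 0) = 0.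
    by rewrite !mxE; lra.
  have := mulf_eq0 b ((x *m x^T) 0 0 + (y *m y^T) 0 0).
  rewrite h eqxx => /esym/orP[/eqP //|].
  rewrite gt_eqF //; case/orP: xy0; rewrite -sqnorm_gt0 => ?.
    exact: ltr_wpDr (sqnorm_ge0 y) _.
  exact: ltr_wpDl (sqnorm_ge0 x) _.
exists a; case/orP: xy0 => ?; [exists x | exists y].
  by rewrite xA b0 scale0r subr0.
by rewrite yA b0 scale0r add0r.
Qed.

(** The reflection in the hyperplane orthogonal to e - v exchanges e and v
    when they differ.  It provides an orthogonal matrix with a prescribed first row. *)
Lemma householder_reflection (R : rcfType) n (v e : 'rV[R]_n) :
  v *m v^T = 1%:M -> e *m e^T = 1%:M ->
  exists Q : 'M[R]_n, [/\ Q^T = Q, Q *m Q = 1%:M & e *m Q = v].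
Proof.
move=> vv ee; have [->|ev] := eqVneq e v.
  by exists 1%:M; rewrite trmx1 !mulmx1.
have [u uE] : exists u, u = e - v by exists (e - v).
pose s := (u *m u^T) 0 0.
have s_gt0 : 0 < s by rewrite /s sqnorm_gt0 uE subr_eq0.
have s0 : s != 0 by rewrite gt_eqF.
have uu : u *m u^T = s%:M by rewrite [LHS]mx11_scalar.
have eu : e *m u^T = (s / 2)%:M.
  have -> : s / 2 = (e *m u^T) 0 0; last by rewrite [LHS]mx11_scalar.
  have e1 : (e *m e^T) 0 0 = 1 by rewrite ee mxE.
  have v1 : (v *m v^T) 0 0 = 1 by rewrite vv mxE.
  have -> : s = (e *m e^T) 0 0 + (v *m v^T) 0 0 - 2 * (e *m v^T) 0 0.
    rewrite /s uE linearB /= mulmxBl !mulmxBr.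
    by rewrite -(mx11_tr (v *m e^T)) trmx_mul trmxK !mxE; ring.
  rewrite e1 v1 uE linearB /= mulmxBr ee.
  rewrite [RHS]mxE [in RHS]mxE [(- _ : 'M_1) _ _]mxE eqxx mulr1n.
  by set t := (_ *m _) 0 0; field.
exists (1%:M - (2 / s) *: (u^T *m u)); split.
- by rewrite linearB /= trmx1 linearZ /= trmx_mul trmxK.
- rewrite mulmxBl mul1mx !mulmxBr mulmx1 -scalemxAl -scalemxAr.
  rewrite mulmxA -(mulmxA u^T u) uu -mulmxA mul_scalar_mx -scalemxAr !scalerA.
  rewrite (_ : 2 / s * (2 / s * s) = 2 / s + 2 / s); last by field.
  rewrite scalerDl; apply/matrixP => i j; rewrite !mxE; ring.
- rewrite mulmxBr mulmx1 -scalemxAr mulmxA eu mul_scalar_mx scalerA.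
  rewrite (_ : 2 / s * (s / 2) = 1) ?scale1r ?uE; last by field.
  by rewrite opprB addrCA subrr addr0.
Qed.

(** Deflation: a reflection that sends the first basis vector e to a unit
    eigenvector turns A into a matrix B that has e as an eigenvector, hence, by
    symmetry, into a block diagonal matrix whose second block is smaller. *)
Theorem symmetric_spectral (R : rcfType) n (A : 'M[R]_n) : A^T = A ->
  exists (P : 'M[R]_n) (d : 'rV[R]_n),
    P *m P^T = 1%:M /\ P *m A *m P^T = diag_mx d.
Proof.
elim: n A => [|n IHn] A symA.
  by exists 1%:M, 0; split; apply/matrixP => -[].
have [a [w [w0 wA]]] := symmetric_eigenvector symA.
have [s s_gt0 ww] : exists2 s : R, 0 < s & w *m w^T = s%:M.
  by exists ((w *m w^T) 0 0); rewrite ?sqnorm_gt0 // -mx11_scalar.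
pose v := (Num.sqrt s)^-1 *: w.
have vv : v *m v^T = 1%:M.
  rewrite /v linearZ /= -scalemxAl -scalemxAr scalerA ww.
  by rewrite scale_scalar_mx -invfM -expr2 sqr_sqrtr ?ltW // mulVf // gt_eqF.
have vA : v *m A = a *: v by rewrite /v -scalemxAl wA !scalerA mulrC.
pose e : 'rV[R]_(1 + n) := row_mx 1%:M 0.
have ee : e *m e^T = 1%:M.
  by rewrite /e tr_row_mx mul_row_col trmx1 trmx0 mulmx1 mulmx0 addr0.
have [Q [symQ QQ eQ]] := householder_reflection vv ee.
pose B : 'M[R]_(1 + n) := Q *m A *m Q.
have symB : B^T = B by rewrite /B !trmx_mul symQ symA mulmxA.
have eB : e *m B = a *: e.
  by rewrite /B !mulmxA eQ vA -scalemxAl -eQ -mulmxA QQ mulmx1.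
have Bblock : B = block_mx a%:M 0 0 (drsubmx B).
  have uB : usubmx B = row_mx a%:M 0.
    have := eB; rewrite -{1}[B]vsubmxK /e mul_row_col mul1mx mul0mx addr0 => ->.
    by rewrite scale_row_mx scaler0 scale_scalar_mx mulr1.
  have urB : ursubmx B = 0 by rewrite /ursubmx uB row_mxKr.
  have dlB : dlsubmx B = 0 by rewrite -[B]symB -trmx_ursub urB trmx0.
  by rewrite -{1}[B]submxK urB dlB /ulsubmx uB row_mxKl.
have symB' : (drsubmx B)^T = drsubmx B by rewrite trmx_drsub symB.
have [P [d [PP PBP]]] := IHn _ symB'.
pose P1 : 'M[R]_(1 + n) := block_mx 1%:M 0 0 P.
have P1P1 : P1 *m P1^T = 1%:M.
  rewrite /P1 tr_block_mx mulmx_block !trmx0 trmx1 !mulmx0 !mul0mx !addr0 add0r.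
  by rewrite mulmx1 PP -scalar_mx_block.
have P1B : P1 *m B *m P1^T = diag_mx (row_mx a%:M d).
  rewrite Bblock /P1 tr_block_mx !mulmx_block !trmx0 trmx1.
  rewrite !mulmx0 !mul0mx !addr0 !add0r !mulmx1 mul1mx PBP.
  rewrite diag_mx_row; congr block_mx; rewrite ?mul0mx //.
  by apply/matrixP=> i j; rewrite !ord1 !mxE eqxx.
exists (P1 *m Q), (row_mx a%:M d); split.
  by rewrite trmx_mul symQ -!mulmxA (mulmxA Q) QQ mul1mx.
by rewrite trmx_mul symQ -P1B /B !mulmxA.
Qed.

Lemma symmetric_nonzero_eigenvector (R : rcfType) n (A : 'M[R]_n) :
  A^T = A -> A != 0 ->
  exists a (v : 'rV[R]_n), [/\ a != 0, v *m v^T = 1%:M & v *m A = a *: v].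
Proof.
move=> /symmetric_spectral[P [d [PP PAP]]] A0.
have PA : P *m A = diag_mx d *m P by rewrite -PAP -!mulmxA (mulmx1C PP) mulmx1.
have [i di] : exists i, d 0 i != 0.
  apply/existsP; apply: contraNT A0 => /existsPn d0.
  have {}d0 : d = 0 by apply/rowP=> i; apply/eqP; rewrite mxE -[_ == _]negbK.
  by rewrite -[A]mul1mx -(mulmx1C PP) -mulmxA PA d0 linear0 mul0mx mulmx0.
exists (d 0 i), (row i P); split=> //.
  apply/matrixP=> j k; rewrite !ord1; have /matrixP/(_ i i) := PP.
  by rewrite !mxE !eqxx => <-; apply: eq_bigr => l _; rewrite !mxE.
by rewrite -row_mul PA; apply/rowP=> j; rewrite mul_diag_mx !mxE.
Qed.

(** * Inertia *)

Definition pos_ind (R : realDomainType) n (d : 'rV[R]_n) := [set i | 0 < d 0 i].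
Definition neg_ind (R : realDomainType) n (d : 'rV[R]_n) := [set i | d 0 i < 0].

(** The diagonal form is reached by a congruence and not by an orthogonal
    change of basis, so that its positive entries can be scaled to 1. *)
Definition inertia (R : realFieldType) n (A : 'M[R]_n) (p q : nat) :=
  exists (P : 'M[R]_n) (d : 'rV[R]_n),
    [/\ P \in unitmx, P *m A *m P^T = diag_mx d,
        #|pos_ind d| = p & #|neg_ind d| = q].

Definition idx_proj (R : pzRingType) n (I : {set 'I_n}) : 'M[R]_n :=
  diag_mx (\row_i (i \in I)%:R).

Lemma mulmx_idx_proj (R : pzRingType) m n (I : {set 'I_n}) (A : 'M[R]_(m, n)) :
  A *m idx_proj R I = \matrix_(i, j) (if j \in I then A i j else 0).
Proof.
apply/matrixP=> i j; rewrite mul_mx_diag !mxE.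
by case: ifP => _; rewrite ?mulr1 ?mulr0.
Qed.

Lemma tr_idx_proj (R : pzRingType) n (I : {set 'I_n}) :
  (idx_proj R I)^T = idx_proj R I.
Proof. exact: tr_diag_mx. Qed.

Lemma idx_projM (R : pzRingType) n (I J : {set 'I_n}) :
  idx_proj R I *m idx_proj R J = idx_proj R (I :&: J).
Proof.
rewrite mulmx_idx_proj; apply/matrixP=> i j; rewrite !mxE in_setI.
by have [->|_] := eqVneq i j; case: (j \in I); case: (j \in J);
   rewrite ?mulr0n.
Qed.

Lemma idx_proj_idem (R : pzRingType) n (I : {set 'I_n}) :
  idx_proj R I *m idx_proj R I = idx_proj R I.
Proof. by rewrite idx_projM setIid. Qed.

Lemma idx_proj_compl (R : pzRingType) n (I : {set 'I_n}) :
  idx_proj R I + idx_proj R (~: I) = 1%:M.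
Proof.
rewrite -diag_const_mx -linearD; congr diag_mx; apply/rowP=> j.
by rewrite !mxE in_setC; case: (_ \in _); rewrite ?addr0 ?add0r.
Qed.

Lemma rank_diag_mx (F : fieldType) n (d : 'rV[F]_n) :
  \rank (diag_mx d) = (\sum_i (d 0 i != 0)%R)%N.
Proof.
elim: n d => [|n IHn] d; first by rewrite big_ord0 [diag_mx d]flatmx0 mxrank0.
rewrite -{1}[d](@hsubmxK _ 1 1 n) (@diag_mx_row _ n 1).
rewrite (@rank_diag_block_mx _ 1 1 n n) IHn [RHS]big_ord_recl; congr (_ + _)%N.
  have -> : diag_mx (lsubmx (d : 'rV_(1 + n))) = const_mx (d 0 ord0).
    apply/matrixP=> i j; rewrite !ord1 !mxE eqxx mulr1n.
    by congr (d 0 _); apply: val_inj.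
  rewrite rank_rV; congr (nat_of_bool (~~ _)).
  by apply/eqP/eqP => [/matrixP/(_ 0 0)|->]; rewrite ?const_mx0 ?mxE.
by apply: eq_bigr => i _; rewrite mxE rshift1.
Qed.

Lemma rank_idx_proj (F : fieldType) n (I : {set 'I_n}) :
  \rank (idx_proj F I) = #|I|.
Proof.
rewrite rank_diag_mx -sum1_card [RHS]big_mkcond /=; apply: eq_bigr => i _.
by rewrite mxE; case: (_ \in _); rewrite ?oner_eq0 ?eqxx.
Qed.

Lemma inertia_rank (R : realFieldType) n (A : 'M[R]_n) p q :
  inertia A p q -> \rank A = (p + q)%N.
Proof.
move=> [P [d [uP PAP <- <-]]].
have rankPA : \rank (P *m A *m P^T) = \rank A.
  by rewrite mxrankMfree ?row_free_unit ?unitmx_tr // -mxrank_tr trmx_mul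
             mxrankMfree ?row_free_unit ?unitmx_tr // mxrank_tr.
rewrite -rankPA PAP rank_diag_mx -!sum1_card [X in (X + _)%N]big_mkcond.
rewrite [X in (_ + X)%N]big_mkcond -big_split /=; apply: eq_bigr => i _.
by rewrite !inE; case: ltrgt0P.
Qed.

Lemma inertia_congr (R : realFieldType) n (A P : 'M[R]_n) p q :
  P \in unitmx -> inertia A p q -> inertia (P *m A *m P^T) p q.
Proof.
move=> uP [Q [d [uQ QAQ dp dq]]]; exists (Q *m invmx P), d; split=> //.
  by rewrite unitmx_mul uQ unitmx_inv.
by rewrite trmx_mul trmx_inv !mulmxA mulmxKV // mulmxK ?unitmx_tr.
Qed.

Lemma inertia_opp (R : realFieldType) n (A : 'M[R]_n) p q :
  inertia A p q -> inertia (- A) q p.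
Proof.
move=> [P [d [uP PAP dp dq]]]; exists P, (- d); split=> //.
- by rewrite mulmxN mulNmx PAP linearN.
- by rewrite -dq; apply: eq_card => i; rewrite !inE mxE oppr_gt0.
- by rewrite -dp; apply: eq_card => i; rewrite !inE mxE oppr_lt0.
Qed.

(** The combinations of the rows of P that avoid the p positive entries of the
    diagonal form are a space of dimension n - p on which A is nonpositive; it
    meets every space of dimension more than p. *)
Lemma inertia_nonpos_vector (R : realFieldType) n (A : 'M[R]_n) p q m
    (U : 'M[R]_(m, n)) :
  inertia A p q -> (p < \rank U)%N ->
  exists v : 'rV[R]_n, [/\ v != 0, (v <= U)%MS & (v *m A *m v^T) 0 0 <= 0].
Proof.
move=> [P [d [uP PAP dp _]]] ltpU.
pose K := kermx (invmx P *m idx_proj R (pos_ind d)).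
have rK : \rank K = (n - p)%N.
  rewrite mxrank_ker -mxrank_tr trmx_mul mxrankMfree ?mxrank_tr.
    by rewrite rank_idx_proj dp.
  by rewrite row_free_unit unitmx_tr unitmx_inv.
have UK0 : (U :&: K)%MS != 0.
  rewrite -mxrank_eq0 -lt0n -(ltn_add2l (\rank (U + K)%MS)) addn0.
  rewrite mxrank_sum_cap rK; apply: leq_ltn_trans (rank_leq_col _) _.
  have := leq_trans ltpU (rank_leq_col U); lia.
have := nz_row_sub (U :&: K)%MS; rewrite sub_capmx => /andP[vU vK].
set v := nz_row _ in vU vK.
exists v; split=> //; first by rewrite nz_row_eq0.
pose x := v *m invmx P.
have vE : v = x *m P by rewrite mulmxKV.
have {vK} : x *m idx_proj R (pos_ind d) = 0.
  by rewrite -mulmxA; apply/sub_kermxP.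
rewrite mulmx_idx_proj vE => /rowP x0.
rewrite trmx_mul !mulmxA -(mulmxA x P) -(mulmxA x) PAP mul_mx_diag mxE.
apply: sumr_le0 => i _; rewrite !mxE.
have := x0 i; rewrite !mxE inE; case: ltP => [_ -> | d0 _].
  by rewrite !mul0r.
by rewrite mulrAC mulr_ge0_le0 // -expr2 sqr_ge0.
Qed.

(** Dividing the rows of P with a positive diagonal entry by the square root of
    that entry. *)
Lemma inertia_pos_normalized (R : rcfType) n (A : 'M[R]_n) p q :
  inertia A p q -> exists (P : 'M[R]_n) (d : 'rV[R]_n),
    [/\ P \in unitmx, P *m A *m P^T = diag_mx d, #|pos_ind d| = p &
        forall i, 0 < d 0 i -> d 0 i = 1].
Proof.
move=> [P [d [uP PAP dp _]]].
pose g : 'rV[R]_n := \row_i if 0 < d 0 i then (Num.sqrt (d 0 i))^-1 else 1.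
have gE i : g 0 i ^+ 2 * d 0 i = if 0 < d 0 i then 1 else d 0 i.
  rewrite mxE; case: ifP => [d0|_]; last by rewrite expr1n mul1r.
  by rewrite exprVn sqr_sqrtr ?ltW // mulVf // gt_eqF.
exists (diag_mx g *m P), (\row_i (g 0 i ^+ 2 * d 0 i)); split.
- rewrite unitmx_mul uP andbT unitmxE det_diag unitfE; apply/prodf_neq0 => i _.
  rewrite mxE; case: ifP => [d0|_]; rewrite ?oner_eq0 //.
  by rewrite invr_eq0 gt_eqF ?sqrtr_gt0.
- rewrite trmx_mul tr_diag_mx -!mulmxA (mulmxA A) (mulmxA P) (mulmxA P) PAP.
  rewrite !mulmx_diag; congr diag_mx; apply/rowP=> i; rewrite !mxE; ring.
- rewrite -dp; apply: eq_card => i; rewrite !inE mxE gE.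
  by case: ifP => // _; rewrite ltr01.
- by move=> i; rewrite mxE gE; case: ifP => // ->.
Qed.

(** As the congruence is orthogonal, it is a similarity, and the diagonal entries
    are the eigenvalues. *)
Lemma nb_eigenvalues_orthodiag (R : realType) n (S : pred R) (A P : 'M[R]_n) d :
  P *m P^T = 1%:M -> P *m A *m P^T = diag_mx d ->
  nb_eigenvalues S A = #|[set i | S (d 0 i)]|.
Proof.
move=> PP PAP.
have cA : char_poly A = \prod_(a <- [seq d 0 i | i <- enum 'I_n]) ('X - a%:P).
  rewrite big_map big_enum /=.
  have -> : char_poly A = char_poly (diag_mx d).
    pose Q := map_mx polyC P; have QQ : Q *m Q^T = 1%:M.
      by rewrite /Q map_trmx -map_mxM PP map_mx1.
    rewrite /char_poly -PAP.
    have -> : char_poly_mx (P *m A *m P^T) = Q *m char_poly_mx A *m Q^T.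
      rewrite /char_poly_mx mulmxBr mulmxBl.
      rewrite mul_mx_scalar -scalemxAl QQ scalemx1.
      by rewrite !map_mxM /Q map_trmx.
    by rewrite !det_mulmx mulrAC -det_mulmx QQ det1 mul1r.
  rewrite char_poly_trig ?diag_mx_is_trig //.
  by apply: eq_bigr => i _; rewrite !mxE eqxx mulr1n.
rewrite (nb_eigenvalues_split _ cA) -sum1_count big_map big_enum_cond /=.
by rewrite -sum1_card; apply: eq_bigl => i; rewrite inE.
Qed.

Lemma signature_inertia (R : realType) n (A : 'M[R]_n) p q :
  A^T = A -> has_signature A p q -> inertia A p q.
Proof.
move=> /symmetric_spectral[P [d [PP PAP]]] [Ap Aq]; exists P, d; split=> //.
- by case: (mulmx1_unit PP).
- by rewrite -Ap (nb_eigenvalues_orthodiag _ PP PAP).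
- by rewrite -Aq (nb_eigenvalues_orthodiag _ PP PAP).
Qed.

(** * Pencils of bounded rank *)

Lemma horner_det_pencil (F : comNzRingType) n (A B : 'M[F]_n) t :
  (\det (map_mx polyC A + 'X *: map_mx polyC B)).[t] = \det (A + t *: B).
Proof.
rewrite -[LHS]/(horner_eval t _) -det_map_mx; congr (\det _).
by apply/matrixP=> i j; rewrite !mxE /= /horner_eval !hornerE.
Qed.

(** The determinant of a pencil is a polynomial in t; one that vanishes off 0 has
    infinitely many roots, hence vanishes at 0 too. *)
Lemma det_pencil_continuation (F : numFieldType) n (A B : 'M[F]_n) :
  (forall t, t != 0 -> \det (A + t *: B) = 0) -> \det A = 0.
Proof.
move=> det0; set pol := \det (map_mx polyC A + 'X *: map_mx polyC B).
suff pol0 : pol = 0.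
  by rewrite -[A]addr0 -(scale0r B) -horner_det_pencil -/pol pol0 horner0.
apply: (@roots_geq_poly_eq0 _ _ [seq i.+1%:R | i <- iota 0 (size pol)]).
- apply/allP=> _ /mapP[i _ ->].
  by rewrite /root horner_det_pencil det0 // pnatr_eq0.
- rewrite map_inj_uniq ?iota_uniq // => i j /eqP.
  by rewrite eqr_nat => /eqP[].
- by rewrite size_map size_iota.
Qed.

(** Bordering argument.  Choose P and Q with P A Q = 1 of size r = rank A.  The
    minor of A + t N of size r + 1 on the rows P, w and the columns Q, z
    vanishes by the bound on the rank.  As w A = 0, its last row is divisible
    by t, and after this division (the matrix T below) it becomes at t = 0
    block triangular, with diagonal blocks 1 and w N z. *)
Lemma bounded_rank_kernel_isotropic (F : numFieldType) n (A N : 'M[F]_n)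
    (w : 'rV[F]_n) (z : 'cV[F]_n) :
  (forall t, (\rank (A + t *: N)%R <= \rank A)%N) ->
  w *m A = 0 -> A *m z = 0 -> w *m N *m z = 0.
Proof.
move=> rankAN wA Az.
have [P [Q PAQ]] : exists (P : 'M[F]_(\rank A, n)) (Q : 'M[F]_(n, \rank A)),
    P *m A *m Q = 1%:M.
  have /row_freeP[Q rQ] := row_base_free A.
  have /row_fullP[P cP] := col_base_full A.
  exists P, Q; transitivity (P *m (col_base A *m row_base A) *m Q).
    by rewrite mulmx_base.
  by rewrite mulmxA cP mul1mx.
pose K0 : 'M[F]_(\rank A + 1) := block_mx 1%:M 0 (w *m N *m Q) (w *m N *m z).
pose K1 : 'M[F]_(\rank A + 1) := block_mx (P *m N *m Q) (P *m N *m z) 0 0.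
have det0 (t : F) : t != 0 -> \det (K0 + t *: K1) = 0.
  move=> t0; apply/eqP; apply: contraT => detK.
  pose T : 'M[F]_(\rank A + 1) := block_mx 1%:M 0 0 t%:M.
  have TK : T *m (K0 + t *: K1) = col_mx P w *m (A + t *: N) *m row_mx Q z.
    rewrite /T /K0 /K1 scale_block_mx add_block_mx mulmx_block.
    rewrite !scaler0 !addr0 !add0r !mul1mx !mul0mx !mul_scalar_mx.
    rewrite !addr0 !add0r.
    rewrite (mul_col_mx P) (mul_col_row (P *m _)).
    rewrite !mulmxDr !mulmxDl -!scalemxAr -!scalemxAl.
    by rewrite PAQ wA !mul0mx -(mulmxA P A z) Az mulmx0 !add0r.
  have : row_free (T *m (K0 + t *: K1)).
    rewrite row_free_unit unitmx_mul !unitmxE !unitfE detK andbT.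
    by rewrite /T det_lblock det1 mul1r det_scalar1.
  rewrite /row_free TK => /eqP rk.
  have : (\rank A + 1 <= \rank (A + t *: N)%R)%N.
    rewrite -rk; apply: leq_trans (mxrankM_maxl _ _) _.
    exact: mxrankM_maxr.
  by rewrite addn1 ltnNge rankAN.
have := det_pencil_continuation det0.
rewrite /K0 det_lblock det1 mul1r det_mx11 => wNz.
by rewrite [LHS]mx11_scalar wNz raddf0.
Qed.

(** * Spaces of symmetric matrices of constant inertia *)

(** Injectivity of the restriction to an off-diagonal block, the heart of the
    proof: E and F project onto the positive coordinates and onto the others,
    and the blocks E N E and F N F are shown to vanish in turn. *)
Lemma inertia_pencil_eq0 (R : rcfType) n (d : 'rV[R]_n) (N : 'M[R]_n) p q :
  let E := idx_proj R (pos_ind d) in let F := idx_proj R (~: pos_ind d) in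
  (forall i, 0 < d 0 i -> d 0 i = 1) -> #|pos_ind d| = p ->
  (forall t, inertia (diag_mx d + t *: N) p q) ->
  N^T = N -> E *m N *m F = 0 -> N = 0.
Proof.
move=> E F d1 dp DNpq symN ENF; set D := diag_mx d in DNpq.
have DE : D *m E = E.
  rewrite mulmx_idx_proj; apply/matrixP=> i j; rewrite !mxE !inE.
  have [<-|_] := eqVneq i j; last by rewrite if_same.
  by rewrite !mulr1n; case: ifP => [/d1|].
have EF : E + F = 1%:M := idx_proj_compl R _.
have symE : E^T = E := tr_idx_proj R _.
have symF : F^T = F := tr_idx_proj R _.
have symD : D^T = D := tr_diag_mx _.
have ED : E *m D = E by rewrite -symE -[D]symD -trmx_mul DE.
have EE : E *m E = E := idx_proj_idem R _.
have FE : F *m E = 0.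
  rewrite /F /E idx_projM setIC setICr; apply/matrixP=> i j.
  by rewrite !mxE inE mul0rn.
have FNE : F *m N *m E = 0.
  by apply: trmx_inj; rewrite trmx0 !trmx_mul symF symE symN mulmxA.
(* An eigenvector of the block for the eigenvalue a is in the kernel of the
   member t = - 1 / a of the pencil, yet it is not isotropic for N. *)
have ENE : E *m N *m E = 0.
  apply/eqP; apply: contraT => /symmetric_nonzero_eigenvector[|a [v [a0 vv vN]]].
    by rewrite !trmx_mul symE symN mulmxA.
  have vE : v *m E = v.
    apply: (scalerI a0); rewrite scalemxAl -vN.
    by rewrite -!mulmxA EE !mulmxA.
  have {}vN : v *m N = a *: v.
    rewrite -vN !mulmxA vE -[LHS]mulmx1 -EF mulmxDr.
    by rewrite -{2}vE -!mulmxA (mulmxA E) ENF mulmx0 addr0.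
  have vD : v *m D = v by rewrite -vE -mulmxA ED.
  have rankD t : \rank (D + t *: N)%R = (p + q)%N := inertia_rank (DNpq t).
  pose A := D - a^-1 *: N.
  have vA : v *m A = 0.
    by rewrite mulmxBr vD -scalemxAr vN scalerA mulVf // scale1r subrr.
  have symA : A^T = A by rewrite linearB /= linearZ /= symD symN.
  have Av : A *m v^T = 0 by apply: trmx_inj; rewrite trmx_mul trmxK symA trmx0.
  have rankA t : (\rank (A + t *: N)%R <= \rank A)%N.
    by rewrite /A -addrA -scaleNr -scalerDl !rankD.
  have := bounded_rank_kernel_isotropic rankA vA Av.
  rewrite vN -scalemxAl vv => /matrixP/(_ 0 0).
  rewrite !mxE eqxx mulr1 => a_eq0.
  by rewrite a_eq0 eqxx in a0.
have EN : E *m N = 0 by rewrite -[LHS]mulmx1 -EF mulmxDr ENE ENF addr0.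
have NE : N *m E = 0 by rewrite -[LHS]mul1mx -EF mulmxDl !mulmxA ENE FNE addr0.
apply/eqP; apply: contraT => /(symmetric_nonzero_eigenvector symN).
move=> [a [y [a0 yy yN]]].
have yE : y *m E = 0.
  by apply: (scalerI a0); rewrite scaler0 scalemxAl -yN -mulmxA NE mulmx0.
have [h yDy] : exists h, y *m D *m y^T = h%:M.
  by exists ((y *m D *m y^T) 0 0); exact: mx11_scalar.
(* Chosen so that the form D + t N takes the value 1 at y. *)
pose t := (1 - h) / a.
have [|x [x0 /sub_addsmxP[[k c] /= xE]]] := inertia_nonpos_vector (DNpq t)
    (U := (E + y)%MS).
  have Ey0 : (E :&: y)%MS = 0.
    apply/eqP; rewrite -submx0; apply/rV_subP=> u; rewrite sub_capmx.
    move=> /andP[/submxP[b ->] /submxP[b' e]]; have := congr1 (mulmx^~ E) e.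
    by rewrite -!mulmxA EE yE mulmx0 => ->; rewrite sub0mx.
  rewrite mxrank_disjoint_sum // rank_idx_proj dp rank_rV.
  by rewrite (_ : y != 0) ?addn1 // -sqnorm_gt0 yy mxE eqxx.
rewrite leNgt => /negP[]; set e := k *m E in xE.
have eE : e *m E = e by rewrite -mulmxA EE.
have eN : e *m N = 0 by rewrite -mulmxA EN mulmx0.
have eD : e *m D = e by rewrite -mulmxA ED.
have ey : e *m y^T = 0.
  apply: trmx_inj; rewrite trmx_mul trmxK trmx0 -eE trmx_mul symE.
  by rewrite mulmxA yE mul0mx.
have ye : y *m e^T = 0 by apply: trmx_inj; rewrite trmx_mul trmxK trmx0 ey.
have Dey : y *m D *m e^T = 0.
  by rewrite -mulmxA -[D]symD -trmx_mul eD ye.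
pose b := c 0 0.
have {}xE : x = e + b *: y by rewrite xE [c]mx11_scalar mul_scalar_mx.
have -> : (x *m (D + t *: N) *m x^T) 0 0 = (e *m e^T) 0 0 + b ^+ 2.
  have -> : x *m (D + t *: N) = e + b *: (y *m D) + (t * b * a) *: y.
    rewrite mulmxDr -scalemxAr xE !mulmxDl eN eD -!scalemxAl yN add0r.
    by rewrite !scalerA.
  rewrite xE linearD /= linearZ /= !mulmxDl !mulmxDr -!scalemxAr -!scalemxAl.
  rewrite ey ye Dey yy yDy !scaler0 !addr0 !add0r !scale_scalar_mx.
  by rewrite !mxE eqxx !mulr1n /t; field.
have [b0|b0] := eqVneq b 0.
  by rewrite b0 expr0n addr0 sqnorm_gt0; move: x0; rewrite xE b0 scale0r addr0.
by rewrite ltr_wpDl ?sqnorm_ge0 // exprn_even_gt0.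
Qed.

(** Such matrices are combinations of the elementary matrices whose row is in I
    and whose column is not. *)
Lemma dim_off_diag_block (F : fieldType) n (I : {set 'I_n})
    (L : {vspace 'M[F]_n}) :
  (forall N, N \in L -> idx_proj F I *m N *m idx_proj F (~: I) = N) ->
  (\dim L <= #|I| * (n - #|I|))%N.
Proof.
move=> LI; pose s := [seq (delta_mx k.1 k.2 : 'M[F]_n) | k in setX I (~: I)].
have -> : (#|I| * (n - #|I|) = size s)%N.
  by rewrite size_image cardsX [#|~: I|]cardsCs setCK card_ord.
apply: leq_trans (dim_span s); apply/dimvS/subvP=> N /LI <-.
rewrite [X in X \in _]matrix_sum_delta.
apply: memv_suml => i _; apply: memv_suml => j _.
have [/andP[iI jI]|] := boolP ((i \in I) && (j \in ~: I)).
  apply/memvZ/memv_span/mapP; exists (i, j) => //.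
  by rewrite mem_enum in_setX iI.
rewrite mulmx_idx_proj mul_diag_mx mxE mxE mxE.
case: (i \in I) => //= [/negbTE->|_]; first by rewrite scale0r mem0v.
by rewrite mul0r if_same scale0r mem0v.
Qed.

Lemma dim_const_inertia (R : rcfType) n (M : 'M[R]_n) (L : {vspace 'M[R]_n})
    p q :
  (forall N, N \in L -> N^T = N) ->
  (forall N, N \in L -> inertia (M + N) p q) ->
  (\dim L <= p * (n - p))%N.
Proof.
move=> symL MLpq.
have := MLpq 0 (mem0v L); rewrite addr0.
move=> /inertia_pos_normalized[P [d [uP PMP dp d1]]].
pose E := idx_proj R (pos_ind d); pose F := idx_proj R (~: pos_ind d).
pose f := linfun (mulmxr (P^T *m F) \o mulmx (E *m P)).
have fE N : f N = E *m (P *m N *m P^T) *m F by rewrite lfunE /= !mulmxA.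
(* Congruence by P preserves the inertia, so an element of the kernel spans a
   pencil through the normal form of M. *)
have kerf : (L :&: lker f = 0)%VS.
  apply/eqP; rewrite -subv0; apply/subvP=> N; rewrite memv_cap memv_ker fE memv0.
  move=> /andP[NL /eqP phiN].
  have : P *m N *m P^T = 0.
    apply: inertia_pencil_eq0 d1 dp _ _ phiN => [t|].
      rewrite -PMP scalemxAl scalemxAr -mulmxDl -mulmxDr.
      exact/inertia_congr/MLpq/memvZ.
    by rewrite !trmx_mul trmxK symL ?mulmxA.
  move=> /(congr1 (mulmx^~ (invmx P^T))); rewrite mulmxK ?unitmx_tr // mul0mx.
  by move=> /(congr1 (mulmx (invmx P))); rewrite mulKmx // mulmx0 => /eqP.
rewrite -(limg_dim_eq kerf) -dp; apply: dim_off_diag_block => N.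
move=> /memv_imgP[N' _ ->]; rewrite fE.
by rewrite -!mulmxA idx_proj_idem !mulmxA idx_proj_idem.
Qed.

Theorem theorem11 (R : realType) (p q n : nat) (hpq : (p + q <= n)%N) :
  (a_sym R n p q <= minn p q * (n - minn p q))%N.
Proof.
have [S [M [L [symM symL -> <-]]] Spq] := a_sym_attained R hpq.
have Lpq N : N \in L -> inertia (M + N) p q.
  move=> NL; apply: signature_inertia; first by rewrite linearD /= symM symL.
  by apply: Spq; exists N.
rewrite /minn; case: ifP => _; first exact: dim_const_inertia symL Lpq.
apply: (dim_const_inertia (M := - M) (q := p) symL) => N NL.
rewrite -[N]opprK -opprD; apply: inertia_opp; apply: Lpq.
by rewrite memvN.
Qed.
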